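(* Let $p$ be a prime and $n\ge 1$. The Sylow $p$-subgroup of the symmetric group of degree $p^n$ has a minimal presentation with generators $x_1,x_2,\dots,x_n$ and defining relations $$x_i^p=1\quad (1\le i\le n),\qquad [x_i,\,x_l^{-k}x_jx_l^{k}]=1\quad \text{for all } 1\le l\le n,\ 1\le i<l,\ 1\le j<l,\ 1\le k\le p/2 .$$ (If $p>2$, the condition $k\le p/2$ means $k\le (p-1)/2$.)
   Context: A presentation of a group is called minimal if none of its generators and none of its defining relations can be excluded (i.e. no proper subset of the set of generators generates the group, and no defining relation is a consequence of the other defining relations).
   Formalization: For p=2, n≥3 the full list is not minimal: as x_l^2=1, the relations for (l,i,j) and (l,j,i) imply each other. There the full list is proved to be a presentation, and the list restricted to i≤j is proved minimal. *)

(* Defs.v *)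
From mathcomp Require Import all_boot all_fingroup all_solvable.

Set Implicit Arguments.
Unset Strict Implicit.
Unset Printing Implicit Defensive.

Section Words.

Variable I : Type.

(* Group words over the alphabet I: the letter (i, false) stands for x_i, and
   (i, true) for x_i^-1. *)
Definition word := seq (I * bool).

Definition letterV (a : I * bool) : I * bool := (a.1, ~~ a.2).

Definition wgen (i : I) : word := [:: (i, false)].
Definition winv (w : word) : word := rev (map letterV w).
Definition wexp (w : word) (k : nat) : word := iter k (cat w) [::].
Definition wconj (u v : word) : word := winv v ++ u ++ v.
Definition wcomm (u v : word) : word := winv u ++ winv v ++ u ++ v.

(* The normal closure of R in the free group on I, as a set of unreduced words:
   the last two rules make it invariant under free equivalence. The relation
   w = 1 is a consequence of the relations r = 1, for r in R, exactly when
   normal_closure R w holds. *)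
Inductive normal_closure (R : word -> Prop) : word -> Prop :=
| nc_rel r : R r -> normal_closure R r
| nc_one : normal_closure R [::]
| nc_mul u v : normal_closure R u -> normal_closure R v ->
    normal_closure R (u ++ v)
| nc_inv u : normal_closure R u -> normal_closure R (winv u)
| nc_conj u v : normal_closure R u -> normal_closure R (wconj u v)
| nc_insert u a v : normal_closure R (u ++ v) ->
    normal_closure R (u ++ [:: a; letterV a] ++ v)
| nc_cancel u a v : normal_closure R (u ++ [:: a; letterV a] ++ v) ->
    normal_closure R (u ++ v).

(* Distinct relators are compared as words; a list of relations without repeated
   words is thus represented by the set of its relators. *)
Definition irredundant (R : word -> Prop) : Prop :=
  forall r, R r -> ~ normal_closure (fun s => R s /\ s <> r) r.

End Words.

Section Presentations.

Local Open Scope group_scope.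

Variables (I : finType) (gT : finGroupType).
Implicit Types (G : {set gT}) (x : I -> gT) (R : word I -> Prop).

Definition weval x (w : word I) : gT :=
  \prod_(a <- w) (if a.2 then (x a.1)^-1 else x a.1).

(* The x_i generate G, and the kernel of the induced epimorphism from the free
   group on I onto G is the normal closure of R. *)
Definition presentation G x R : Prop :=
  <<[set x i | i : I]>> = G /\
  forall w : word I, weval x w = 1 <-> normal_closure R w.

Definition minimal_generators G x : Prop :=
  forall J : {set I}, J \proper [set: I] -> <<[set x i | i in J]>> <> G.

Definition minimal_presentation G x R : Prop :=
  [/\ presentation G x R, minimal_generators G x & irredundant R].

End Presentations.

(* The generators are numbered from 0 to n - 1, and k <= p / 2 is written
   without division as k.*2 <= p. *)
Inductive sylow_relator (p n : nat) : word 'I_n -> Prop :=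
| sylow_power (i : 'I_n) : sylow_relator p (wexp (wgen i) p)
| sylow_commutator (l i j : 'I_n) (k : nat) :
    i < l -> j < l -> 1 <= k -> k.*2 <= p ->
    sylow_relator p (wcomm (wgen i) (wconj (wgen j) (wexp (wgen l) k))).

(* For p = 2 the only exponent is k = 1, and conjugation by the involution x_l
   turns [x_i, x_l^-1 x_j x_l] = 1 into [x_l^-1 x_i x_l, x_j] = 1. The relators
   of indices (l, i, j) and (l, j, i) are thus consequences of each other modulo
   x_l^2 = 1, and sylow_relator 2 is redundant as soon as 3 <= n. The family
   below keeps one relator from each such pair. *)
Inductive sylow2_relator (n : nat) : word 'I_n -> Prop :=
| sylow2_power (i : 'I_n) : sylow2_relator (wexp (wgen i) 2)
| sylow2_commutator (l i j : 'I_n) :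
    i <= j -> j < l ->
    sylow2_relator (wcomm (wgen i) (wconj (wgen j) (wgen l))).

(* Main.v *)
Require Import Defs.
From HB Require Import structures.
From mathcomp Require Import all_boot all_fingroup all_solvable.
From mathcomp Require Import generic_quotient ssralg zmodp.
From mathcomp Require boolp.

(* The iterated wreath product: x_n shifts the p blocks of a set on which
   x_0, ..., x_{n-1} act through the block 0. In any group satisfying the
   relations, every word in the generators can be brought to the form
   x_n^e prod_s u_s^(x_n^s), with s ranging over Z/p and words u_s in
   x_0, ..., x_{n-1}, because the conjugates of <x_0, ..., x_{n-1}> by distinct
   powers of x_n commute. In the wreath product e and the values of the u_s are
   determined by the value of the word, so induction on n shows that no further
   relations are needed; counting gives the order of a Sylow subgroup.

   A generator, or a power relator, is shown to be indispensable by killing all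
   the other generators. To violate only the commutator relator (l, i, j, k),
   take two noncommuting elements a and b of order p, let x_l be the shift, and
   let x_j act as b on block 0 and x_i act as a on block k (x_i does both when
   i = j); then pass from l to larger indices by wreath products. *)

Set Implicit Arguments.
Unset Strict Implicit.
Unset Printing Implicit Defensive.

Local Open Scope group_scope.

(** * Words and presented groups *)

Section Evaluation.

Variables (I : Type) (G : groupType).
Implicit Types (x : I -> G) (u v w : word I) (R : word I -> Prop).

Definition letter_val x (a : I * bool) : G :=
  if a.2 then (x a.1)^-1 else x a.1.

Definition word_val x w : G := \prod_(a <- w) letter_val x a.

Lemma word_val_nil x : word_val x [::] = 1.
Proof. exact: big_nil. Qed.

Lemma word_val_cons x a w : word_val x (a :: w) = letter_val x a * word_val x w.
Proof. exact: big_cons. Qed.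

Lemma word_val_cat x u v : word_val x (u ++ v) = word_val x u * word_val x v.
Proof. exact: big_cat. Qed.

Lemma letter_valV x a : letter_val x (letterV a) = (letter_val x a)^-1.
Proof. by case: a => i [] //=; rewrite /letter_val /= invgK. Qed.

Lemma word_val_inv x w : word_val x (winv w) = (word_val x w)^-1.
Proof.
elim: w => [|a w IHw]; first by rewrite word_val_nil invg1.
rewrite /winv map_cons rev_cons -cats1 word_val_cat -/(winv w) IHw.
by rewrite !word_val_cons word_val_nil mulg1 letter_valV invgM.
Qed.

Lemma word_val_gen x i : word_val x (wgen i) = x i.
Proof. by rewrite word_val_cons word_val_nil mulg1. Qed.

Lemma word_val_exp x w k : word_val x (wexp w k) = word_val x w ^+ k.
Proof.
elim: k => [|k IHk]; first exact: word_val_nil.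
by rewrite /wexp iterS word_val_cat -/(wexp w k) IHk expgS.
Qed.

Lemma word_val_conj x u v : word_val x (wconj u v) = word_val x u ^ word_val x v.
Proof. by rewrite !word_val_cat word_val_inv. Qed.

Lemma word_val_comm x u v :
  word_val x (wcomm u v) = [~ word_val x u, word_val x v].
Proof. by rewrite !word_val_cat !word_val_inv. Qed.

Lemma normal_closure_word_val x R w :
    (forall r, R r -> word_val x r = 1) ->
  normal_closure R w -> word_val x w = 1.
Proof.
move=> xR; have cancel_val u a v :
    word_val x (u ++ [:: a; letterV a] ++ v) = word_val x (u ++ v).
  by rewrite !word_val_cat !word_val_cons letter_valV word_val_nil mulg1 mulgV mul1g.
elim=> {w} [r /xR //||u v _ IHu _ IHv|u _ IHu|u v _ IHu|u a v _|u a v _].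
- exact: word_val_nil.
- by rewrite word_val_cat IHu IHv mulg1.
- by rewrite word_val_inv IHu invg1.
- by rewrite word_val_conj IHu conj1g.
- by rewrite cancel_val.
- by rewrite cancel_val.
Qed.

End Evaluation.

Lemma eq_word_val (I : Type) (G : groupType) (x y : I -> G) :
  x =1 y -> word_val x =1 word_val y.
Proof. by move=> xy w; apply: eq_bigr => a _; rewrite /letter_val xy. Qed.

Lemma word_val_map (I J : Type) (G : groupType) (h : I -> J) (x : J -> G) w :
  word_val x [seq (h a.1, a.2) | a <- w] = word_val (x \o h) w.
Proof. exact: big_map. Qed.

Lemma morph_word_val (I : Type) (G H : groupType) (f : G -> H) (x : I -> G) w :
  {morph f : u v / u * v} -> f (word_val x w) = word_val (f \o x) w.
Proof.
move=> fM; have f1 : f 1 = 1 by apply: (mulgI (f 1)); rewrite -fM !mulg1.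
have fV u : f u^-1 = (f u)^-1 by apply: (mulgI (f u)); rewrite -fM !mulgV.
elim: w => [|a w IHw]; first by rewrite !word_val_nil.
by rewrite !word_val_cons fM IHw /letter_val; case: ifP => //= _; rewrite fV.
Qed.

(** * The group presented by a set of relators *)

Section Quotient.

Variables (I : choiceType) (R : word I -> Prop).

(** Two words are identified when u v^-1 lies in the normal closure. [asbool] makes this a boolean
    relation, as the quotient type requires. *)
Let eqR (u v : word I) : bool := boolp.asbool (normal_closure R (u ++ winv v)).

Lemma winvK : involutive (@winv I).
Proof.
move=> w; rewrite /winv map_rev revK -map_comp -[RHS]map_id.
by apply: eq_map => -[i b]; rewrite /letterV /= negbK.
Qed.

Lemma winv_cat (u v : word I) : winv (u ++ v) = winv v ++ winv u.
Proof. by rewrite /winv map_cat rev_cat. Qed.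

Lemma nc_insert_inv (u v w : word I) :
  normal_closure R (u ++ v) -> normal_closure R (u ++ w ++ winv w ++ v).
Proof.
elim: w u v => [//|a w IHw] u v nc_uv.
rewrite /winv map_cons rev_cons -cats1 -/(winv w) -!catA /=.
rewrite -cat1s catA; apply: IHw.
by rewrite -catA; apply: (nc_insert a nc_uv).
Qed.

Lemma nc_cancel_inv (u v w : word I) :
  normal_closure R (u ++ w ++ winv w ++ v) -> normal_closure R (u ++ v).
Proof.
elim: w u v => [//|a w IHw] u v.
rewrite /winv map_cons rev_cons -cats1 -/(winv w) -!catA /=.
rewrite -cat1s catA => /IHw; rewrite -catA; exact: nc_cancel.
Qed.

Lemma nc_trans (u v w : word I) :
  normal_closure R (u ++ winv v) -> normal_closure R (v ++ winv w) ->
  normal_closure R (u ++ winv w).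
Proof.
move=> uv vw; apply: (@nc_cancel_inv _ _ (winv v)); rewrite winvK.
by have := nc_mul uv vw; rewrite -!catA.
Qed.

Lemma nc_sym (u v : word I) :
  normal_closure R (u ++ winv v) -> normal_closure R (v ++ winv u).
Proof. by move/nc_inv; rewrite winv_cat winvK. Qed.

Lemma nc_self (u : word I) : normal_closure R (u ++ winv u).
Proof.
by have := @nc_insert_inv [::] [::] u (nc_one _); rewrite !cats0.
Qed.

Lemma eqR_refl : reflexive eqR.
Proof. by move=> u; apply/boolp.asboolP/nc_self. Qed.

Lemma eqR_sym : symmetric eqR.
Proof.
by move=> u v; apply/boolp.asboolP/boolp.asboolP; apply: nc_sym.
Qed.

Lemma eqR_trans : transitive eqR.
Proof.
move=> v u w /boolp.asboolP uv /boolp.asboolP vw.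
exact/boolp.asboolP/(nc_trans uv vw).
Qed.

Canonical eqR_equiv := EquivRel eqR eqR_refl eqR_sym eqR_trans.

Definition presented := {eq_quot eqR}%qT.
HB.instance Definition _ := EqQuotient.on presented.
HB.instance Definition _ := Choice.on presented.

Definition class_of (w : word I) : presented := \pi_presented%qT w.

Lemma class_eqP u v :
  class_of u = class_of v <-> normal_closure R (u ++ winv v).
Proof.
split=> [/eqmodP/boolp.asboolP //|nc_uv]; exact/eqmodP/boolp.asboolP.
Qed.

Lemma class_repr (c : presented) : class_of (repr c) = c.
Proof. exact: reprK. Qed.

Definition presented_mul (c d : presented) := class_of (repr c ++ repr d).
Definition presented_inv (c : presented) := class_of (winv (repr c)).

(** With representatives u' and v', the word u' v' v^-1 u^-1 is, up to cancellation, the conjugate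
    of v' v^-1 by u'^-1 times u' u^-1. *)
Lemma class_cat u v : presented_mul (class_of u) (class_of v) = class_of (u ++ v).
Proof.
have /class_eqP u'u := class_repr (class_of u).
have /class_eqP v'v := class_repr (class_of v).
apply/class_eqP; rewrite winv_cat.
set u' := repr _ in u'u *; set v' := repr _ in v'v *.
have := nc_mul (nc_conj (winv u') v'v) u'u; rewrite /wconj winvK -!catA.
have := @nc_cancel_inv (u' ++ v' ++ winv v) (winv u) (winv u').
by rewrite winvK -!catA; apply.
Qed.

Lemma class_inv u : presented_inv (class_of u) = class_of (winv u).
Proof.
have /class_eqP/nc_inv u'u := class_repr (class_of u).
apply/class_eqP; rewrite winvK; move: u'u; rewrite winv_cat winvK.
set u' := repr _ => uu'; have := nc_conj u' uu'.
have := @nc_cancel_inv (winv u' ++ u) [::] (winv u').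
by rewrite /wconj winvK !cats0 -!catA; apply.
Qed.

Lemma presented_mulA : associative presented_mul.
Proof.
move=> a b c; rewrite -[a]class_repr -[b]class_repr -[c]class_repr.
by rewrite !class_cat catA.
Qed.

Lemma presented_mul1 : left_id (class_of [::]) presented_mul.
Proof. by move=> a; rewrite -[a]class_repr class_cat. Qed.

Lemma presented_mul1r : right_id (class_of [::]) presented_mul.
Proof. by move=> a; rewrite -[a]class_repr class_cat cats0. Qed.

Lemma presented_mulVr :
  right_inverse (class_of [::]) presented_inv presented_mul.
Proof.
move=> a; rewrite -[a]class_repr class_inv class_cat.
by apply/class_eqP; rewrite cats0; apply: nc_self.
Qed.

Lemma presented_mulV :
  left_inverse (class_of [::]) presented_inv presented_mul.
Proof.
move=> a; rewrite -[a]class_repr class_inv class_cat.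
by apply/class_eqP; rewrite cats0 -{2}[repr a]winvK; apply: nc_self.
Qed.

HB.instance Definition _ := isGroup.Build presented
  presented_mulA presented_mul1 presented_mul1r presented_mulV presented_mulVr.

Lemma class_of_word_val w : class_of w = word_val (fun i => class_of (wgen i)) w.
Proof.
elim: w => [|a w IHw]; first by rewrite word_val_nil.
rewrite word_val_cons -IHw -cat1s -class_cat; congr (_ * _).
by case: a => i [] //; apply: esym (class_inv (wgen i)).
Qed.

End Quotient.

(** This possibly infinite group detects consequences: a word that is trivial for every family
    satisfying the relators is trivial here, hence lies in the normal closure. *)
Lemma exists_presented_group (I : choiceType) (R : word I -> Prop) :
  exists (G : groupType) (y : I -> G),
    forall w, word_val y w = 1 <-> normal_closure R w.
Proof.
exists (presented R), (fun i => class_of R (wgen i)) => w.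
rewrite -class_of_word_val; have := class_eqP R w [::].
by rewrite cats0.
Qed.

(** * The iterated wreath product *)

(* Generators are indexed by nat, with only those below n in play, so that a word
   for n is also a word for n.+1. *)
Definition letters_below (n : nat) (w : word nat) := all (fun a => a.1 < n) w.

Section Relations.

Variables (G : groupType) (p : nat).
Implicit Types (x y : nat -> G) (n : nat).

Definition power_relations n x := forall i, i < n -> x i ^+ p = 1.

Definition commutator_relations (C : nat -> nat -> nat -> nat -> Prop) n x :=
  forall l i j k, l < n -> i < l -> j < l -> C l i j k ->
    commute (x i) (x j ^ (x l ^+ k)).

Definition distinct_conjugates (l i j k : nat) : Prop := 0 < k < p.

Lemma commuteJ (g h z : G) : commute g h -> commute (g ^ z) (h ^ z).
Proof. by rewrite /commute -!conjMg => ->. Qed.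

(** For k > p/2, the relation with exponent p - k and with i and j exchanged is available.
    Conjugating it by x_l^k and using x_l^p = 1 gives the one for k. *)
Lemma distinct_conjugates_half n x :
    power_relations n x ->
    commutator_relations (fun _ _ _ k => 0 < k /\ k.*2 <= p) n x ->
  commutator_relations distinct_conjugates n x.
Proof.
move=> xp xc l i j k ln il jl /andP[k0 kp].
have [k2|k2] := leqP k.*2 p; first exact: xc.
have k'2 : (p - k).*2 <= p by rewrite doubleB leq_subLR -addnn leq_add2r ltnW.
have := xc l j i (p - k) ln jl il (conj _ k'2); rewrite subn_gt0 kp => /(_ isT).
move/(@commuteJ _ _ (x l ^+ k))/commute_sym.
by rewrite -conjgM -expgnDr subnK ?(ltnW kp) // xp // conjg1.
Qed.

Lemma word_val_commute l c x u v :
    (forall i j, i < l -> j < l -> commute (x i) (x j ^ c)) ->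
    letters_below l u -> letters_below l v ->
  commute (word_val x u) (word_val x v ^ c).
Proof.
move=> xc; elim: u => [|a u IHu].
  by move=> _ _; rewrite word_val_nil; apply/commute_sym/commute1.
rewrite word_val_cons => /= /andP[al ul] vl.
apply/commute_sym/commuteM; last exact/commute_sym/IHu.
elim: v vl {IHu} => [|b v IHv] /=.
  by rewrite word_val_nil conj1g => _; apply/commute_sym/commute1.
case/andP=> bl vl; rewrite word_val_cons conjMg.
apply/commute_sym/commuteM; last exact/commute_sym/IHv.
have sgC (g h : G) (s : bool) :
  commute g h -> commute g (if s then h^-1 else h) by case: s => // /commuteV.
have -> : letter_val x b ^ c = if b.2 then (x b.1 ^ c)^-1 else x b.1 ^ c.
  by rewrite /letter_val; case: ifP => //; rewrite conjVg.
exact/sgC/commute_sym/sgC/commute_sym/xc.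
Qed.

Hypothesis p_gt1 : 1 < p.

(** ['Z_p] has p elements only for p > 1. Its addition then reduces modulo p, which y^p = 1 makes
    invisible in the exponent. *)
Lemma expg_Zp (y : G) (a b : 'Z_p) :
  y ^+ p = 1 -> y ^+ (a + b)%R = y ^+ a * y ^+ b.
Proof.
move=> yp; have -> : ((a + b)%R : nat) = (a + b) %% p.
  by congr (_ %% _); apply: Zp_cast.
rewrite -expgnDr [in RHS](divn_eq (a + b) p) expgnDr mulnC expgnA yp.
by rewrite expg1n mul1g.
Qed.

(** [g] is carried past the factors preceding index [e] and absorbed at [e], which occurs exactly
    once. *)
Lemma mulg_prod (I : eqType) (r : seq I) (e : I) (g : G) (F : I -> G) :
    uniq r -> e \in r -> (forall s, s != e -> commute g (F s)) ->
  g * \prod_(s <- r) F s = \prod_(s <- r) (if s == e then g * F s else F s).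
Proof.
move=> + + gF; elim: r => [//|s r IHr] /= /andP[sr ur]; rewrite inE !big_cons.
have [-> _|es /= er] := eqVneq e s.
  rewrite mulgA; congr (_ * _); apply: eq_big_seq => t tr.
  by case: eqP tr sr => // -> ->.
have se : s != e by rewrite eq_sym.
by rewrite mulgA gF // -mulgA IHr.
Qed.

Definition wreath_normal_form n y (e : 'Z_p) (u : 'Z_p -> word nat) : G :=
  y n ^+ e * \prod_(s : 'Z_p) word_val y (u s) ^ (y n ^+ s).

Lemma word_val1 y (a : nat * bool) : letter_val y a = word_val y [:: a].
Proof. by rewrite word_val_cons word_val_nil mulg1. Qed.

(** Moved past y_n^e, the letter becomes its conjugate by y_n^e. This commutes with every factor
    except the one of index e, where it is absorbed. *)
Lemma mul_base_letter n y e u a :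
    power_relations n.+1 y -> commutator_relations distinct_conjugates n.+1 y ->
    a.1 < n -> (forall s, letters_below n (u s)) ->
  letter_val y a * wreath_normal_form n y e u =
  wreath_normal_form n y e (fun s => if s == e then a :: u s else u s).
Proof.
move=> yp yc an un; rewrite /wreath_normal_form.
rewrite mulgA [_ * y n ^+ e]conjgC -mulgA; congr (_ * _).
rewrite (mulg_prod (e := e)) ?index_enum_uniq ?mem_index_enum //.
  apply: eq_bigr => s _; case: eqP => // ->.
  by rewrite word_val_cons conjMg.
(* Once the common conjugation by y_n^e is removed, what remains is conjugation by y_n^(s - e),
   whose exponent lies strictly between 0 and p because s differs from e. *)
move=> s se; have -> : y n ^+ s = y n ^+ (s - e)%R * y n ^+ e.
  by rewrite -expg_Zp ?yp // GRing.subrK.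
rewrite conjgM; apply: commuteJ; rewrite word_val1.
apply: (@word_val_commute n); rewrite ?/letters_below ?all_seq1 //; last exact: un.
move=> i j iN jN; apply: yc => //; rewrite /distinct_conjugates.
have -> : (s - e)%R < p by rewrite -[X in _ < X](Zp_cast p_gt1) ltn_ord.
by rewrite andbT lt0n -[_ == 0]/((s - e)%R == 0%R) GRing.subr_eq0.
Qed.

Lemma mul_top_letter n y e u (b : bool) :
    power_relations n.+1 y ->
  letter_val y (n, b) * wreath_normal_form n y e u =
  wreath_normal_form n y (if b then e - 1 else e + 1)%R u.
Proof.
move=> yp; rewrite /wreath_normal_form mulgA; congr (_ * _).
have yS c : y n ^+ (1 + c : 'Z_p)%R = y n * y n ^+ c by rewrite expg_Zp ?yp ?expg1.
case: b; last by rewrite GRing.addrC yS.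
by apply: (mulgI (y n)); rewrite -yS GRing.addrC GRing.subrK; apply: mulVKg.
Qed.

End Relations.

(** * Permutations in the wreath product with Z/p *)

Section Wreath.

Variables (T : finType) (p : nat).
Implicit Types (e d : 'Z_p) (f g : 'Z_p -> {perm T}).

(** The block is shifted by e first, and f is read at the block reached. This matches the normal
    form, in which the power of the top generator stands on the left. *)
Definition wreath_fun e f (ts : T * 'Z_p) := (f (ts.2 + e)%R ts.1, (ts.2 + e)%R).

Lemma wreath_fun_inj e f : injective (wreath_fun e f).
Proof.
move=> [t s] [t' s'] /pair_equal_spec[/= ft /(@GRing.addIr _ e) ss'].
by move: ft; rewrite ss' => /(@perm_inj _ _) ->.
Qed.

Definition wreath_perm e f : {perm T * 'Z_p} := perm (@wreath_fun_inj e f).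

Lemma eq_wreath_perm e f g : f =1 g -> wreath_perm e f = wreath_perm e g.
Proof. by move=> fg; apply/permP=> ts; rewrite !permE /wreath_fun fg. Qed.

Lemma wreath_permM e f d g :
  wreath_perm e f * wreath_perm d g =
  wreath_perm (e + d)%R (fun s => f (s - d)%R * g s).
Proof.
apply/permP=> -[t s]; rewrite !permE /= /wreath_fun !permE /=.
by rewrite GRing.addrA GRing.addrK.
Qed.

Lemma wreath_perm1 : wreath_perm 0%R (fun=> 1) = 1.
Proof. by apply/permP=> -[t s]; rewrite !permE /wreath_fun /= perm1 GRing.addr0. Qed.

(** [t0] provides a point at which the shifts can be compared: on an empty set all these
    permutations coincide. *)
Lemma wreath_perm_inj (t0 : T) e f d g :
  wreath_perm e f = wreath_perm d g -> e = d /\ f =1 g.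
Proof.
move=> /permP eq_fg; have eq_ed : e = d.
  have := eq_fg (t0, 0%R); rewrite !permE => /pair_equal_spec[_].
  by rewrite !GRing.add0r.
split=> // s; apply/permP=> t; have := eq_fg (t, (s - e)%R).
by rewrite !permE /wreath_fun -eq_ed /= GRing.subrK => /pair_equal_spec[].
Qed.

Lemma base_permM f g :
  wreath_perm 0%R f * wreath_perm 0%R g = wreath_perm 0%R (fun s => f s * g s).
Proof.
rewrite wreath_permM GRing.addr0; apply: eq_wreath_perm => s.
by rewrite GRing.subr0.
Qed.

Lemma base_permX f k : wreath_perm 0%R f ^+ k = wreath_perm 0%R (fun s => f s ^+ k).
Proof.
elim: k => [|k IHk]; first exact/esym/wreath_perm1.
by rewrite expgS IHk base_permM; apply: eq_wreath_perm => s; rewrite expgS.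
Qed.

Lemma base_permJ f d :
  wreath_perm 0%R f ^ wreath_perm d (fun=> 1) =
  wreath_perm 0%R (fun s => f (s - d)%R).
Proof.
apply: (mulgI (wreath_perm d (fun=> 1))); rewrite -conjgC !wreath_permM.
rewrite GRing.addr0 GRing.add0r; apply: eq_wreath_perm => s.
by rewrite mul1g mulg1.
Qed.

Lemma base_perm_commute (t0 : T) f g :
  commute (wreath_perm 0%R f) (wreath_perm 0%R g) <->
  forall s, commute (f s) (g s).
Proof.
rewrite /commute !base_permM; split=> [/(wreath_perm_inj t0)[]|fg] //.
exact: eq_wreath_perm.
Qed.

Definition shift_perm := wreath_perm 1%R (fun=> 1).

Lemma shift_permX k : shift_perm ^+ k = wreath_perm k%:R%R (fun=> 1).
Proof.
elim: k => [|k IHk]; first exact/esym/wreath_perm1.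
rewrite expgS IHk wreath_permM GRing.mulrS.
by apply: eq_wreath_perm => s; rewrite mulg1.
Qed.

Lemma shift_perm_Zp (s : 'Z_p) : shift_perm ^+ s = wreath_perm s (fun=> 1).
Proof. by rewrite shift_permX natr_Zp. Qed.

Definition single (e : 'Z_p) (h : {perm T}) : 'Z_p -> {perm T} :=
  fun s => if s == e then h else 1.

Definition coord_perm e h := wreath_perm 0%R (single e h).

Lemma coord_permM e : {morph coord_perm e : g h / g * h}.
Proof.
move=> g h; rewrite base_permM; apply: eq_wreath_perm => s.
by rewrite /single; case: eqP; rewrite ?mulg1.
Qed.

Lemma coord_permX e h k : coord_perm e h ^+ k = coord_perm e (h ^+ k).
Proof.
rewrite base_permX; apply: eq_wreath_perm => s.
by rewrite /single; case: eqP; rewrite ?expg1n.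
Qed.

Lemma coord_permJ e h d :
  coord_perm e h ^ wreath_perm d (fun=> 1) = coord_perm (e + d)%R h.
Proof.
rewrite base_permJ; apply: eq_wreath_perm => s.
by rewrite /single GRing.subr_eq.
Qed.

Lemma coord_permV e (h : {perm T}) : (coord_perm e h)^-1 = coord_perm e h^-1.
Proof.
apply: (mulgI (coord_perm e h)); rewrite mulgV -coord_permM mulgV.
exact: (coord_permX e 1 0).
Qed.

Lemma coord_permJcoord e (g h : {perm T}) :
  coord_perm e g ^ coord_perm e h = coord_perm e (g ^ h).
Proof. by rewrite !conjgE coord_permV -!coord_permM. Qed.

Lemma coord_perm_inj (t0 : T) e : injective (coord_perm e).
Proof.
move=> g h /(wreath_perm_inj t0)[_ /(_ e)]; by rewrite /single eqxx.
Qed.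

Lemma coord_perm_commute e d (g h : {perm T}) :
  e != d -> commute (coord_perm e g) (coord_perm d h).
Proof.
move=> ed; rewrite /commute !base_permM; apply: eq_wreath_perm => s.
rewrite /single; case: eqP => [->|_]; last by rewrite mulg1 mul1g.
by rewrite (negPf ed) mulg1 mul1g.
Qed.

Lemma coord_perm_commuteE (t0 : T) e (g h : {perm T}) :
  commute (coord_perm e g) (coord_perm e h) <-> commute g h.
Proof.
rewrite /commute -!coord_permM; split=> [/(coord_perm_inj t0)|->] //.
Qed.

Definition wreath_family n (x : nat -> {perm T}) (i : nat) :=
  if i < n then coord_perm 0%R (x i) else shift_perm.

Hypothesis p_gt1 : 1 < p.

Lemma natr_Zp_eq0 k : (k%:R%R == 0%R :> 'Z_p) = (p %| k).
Proof. by rewrite -val_eqE /= val_Zp_nat. Qed.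

Lemma shift_perm_order : shift_perm ^+ p = 1.
Proof.
rewrite shift_permX -[RHS]wreath_perm1; congr wreath_perm.
by apply/eqP; rewrite natr_Zp_eq0.
Qed.

Lemma wreath_power_relations n x :
  power_relations p n x -> power_relations p n.+1 (wreath_family n x).
Proof.
move=> xp i; rewrite ltnS /wreath_family => _; case: ifP => [/xp x1|_].
  rewrite coord_permX x1 -wreath_perm1; apply: eq_wreath_perm => s.
  by rewrite /single if_same.
exact: shift_perm_order.
Qed.

(** At the top level, conjugation by the k-th power of the shift moves block 0 to a different block,
    so the supports are disjoint. At lower levels [coord_perm 0] is a homomorphism. The parameter
    [C] serves both the full family of relations and the family with one relation removed. *)
Lemma wreath_commutator_relations (C : nat -> nat -> nat -> nat -> Prop) n x :
    (forall l i j k, C l i j k -> 0 < k < p) ->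
  commutator_relations C n x -> commutator_relations C n.+1 (wreath_family n x).
Proof.
move=> Cp xc l i j k; rewrite ltnS leq_eqVlt => /orP[/eqP-> |ln] il jl Ck.
  rewrite /wreath_family il jl ltnn shift_permX coord_permJ.
  apply: coord_perm_commute; rewrite GRing.add0r eq_sym natr_Zp_eq0.
  by have /andP[k0 kp] := Cp _ _ _ _ Ck; rewrite gtnNdvd.
rewrite /wreath_family ln (ltn_trans il ln) (ltn_trans jl ln).
have := xc l i j k ln il jl Ck.
rewrite coord_permX coord_permJcoord /commute -!coord_permM => -> //.
Qed.

End Wreath.

(** * The order of the generated wreath product *)

Section WreathOrder.

Variables (T : finType) (p n : nat) (x : nat -> {perm T}).
Hypothesis p_gt1 : 1 < p.

Let H := <<[set x i | i : 'I_n]>>.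
Let x' := wreath_family p n x.
Let K := <<[set x' i | i : 'I_n.+1]>>.

Lemma prod_coord_perm (r : seq 'Z_p) (f : 'Z_p -> {perm T}) :
    uniq r ->
  \prod_(s <- r) coord_perm s (f s) =
  wreath_perm 0%R (fun s => if s \in r then f s else 1).
Proof.
elim: r => [_|s r IHr /= /andP[sr /IHr IH]].
  by rewrite big_nil -(wreath_perm1 T p).
rewrite big_cons IH base_permM; apply: eq_wreath_perm => t.
rewrite /single inE; have [->|] := eqVneq t s; last by rewrite mul1g.
by rewrite (negPf sr) mulg1.
Qed.

Lemma base_perm_prod (f : 'Z_p -> {perm T}) :
  wreath_perm 0%R f = \prod_(s : 'Z_p) coord_perm s (f s).
Proof.
rewrite prod_coord_perm ?index_enum_uniq //; apply: eq_wreath_perm => s.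
by rewrite mem_index_enum.
Qed.

Lemma coord_perm_gen (e : 'Z_p) h : h \in H -> coord_perm e h \in K.
Proof.
have shK : shift_perm T p \in K.
  by apply/mem_gen/imsetP; exists ord_max; rewrite // /x' /wreath_family ltnn.
(* Block e is reached from block 0 by conjugating with the e-th power of the shift. *)
have -> : coord_perm e h = coord_perm 0%R h ^ (shift_perm T p ^+ e).
  by rewrite shift_perm_Zp coord_permJ GRing.add0r.
move=> hH; apply: groupJ; last exact: groupX.
have /gen_prodgP[m [c cx ->]] := hH.
rewrite (big_morph _ (@coord_permM T p 0%R) (esym (coord_permX 0%R 1 0))).
apply: group_prod => i _; have /imsetP[j _ ->] := cx i.
apply/mem_gen/imsetP; exists (widen_ord (leqnSn n) j) => //.
by rewrite /x' /wreath_family /= ltn_ord.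
Qed.

(** An image of a finite set of pairs, so that injectivity of [wreath_perm] yields the count p
    |H|^p. *)
Let wreath_set : {set {perm T * 'Z_p}} :=
  [set wreath_perm ef.1 ef.2 |
    ef : 'Z_p * {ffun 'Z_p -> {perm T}}
    in setX [set: 'Z_p] [set f : {ffun 'Z_p -> {perm T}} | f \in ffun_on H]].

Lemma wreath_setP g :
  reflect (exists e (f : 'Z_p -> {perm T}),
             (forall s, f s \in H) /\ g = wreath_perm e f)
          (g \in wreath_set).
Proof.
apply: (iffP imsetP) => [[[e f]]|[e [f [fH ->]]]].
  rewrite !inE /= => /ffun_onP fH ->; by exists e, f.
exists (e, [ffun s => f s]); last by apply: eq_wreath_perm => s; rewrite ffunE.
by rewrite !inE; apply/ffun_onP=> s; rewrite ffunE.
Qed.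

Lemma group_set_wreath_set : group_set wreath_set.
Proof.
apply/group_setP; split.
  apply/wreath_setP; exists 0%R, (fun=> 1); split; first by move=> _; exact: group1.
  by rewrite wreath_perm1.
move=> _ _ /wreath_setP[e [f [fH ->]]] /wreath_setP[d [g [gH ->]]].
rewrite wreath_permM; apply/wreath_setP; eexists _, _; split; last by [].
by move=> s; rewrite groupM.
Qed.

(** The explicit set is a group containing the generators. Conversely, each of its elements is a
    power of the shift times a product of block components, all of which are generated. *)
Lemma wreath_family_gen : K = wreath_set.
Proof.
apply/eqP; rewrite eqEsubset; apply/andP; split.
  rewrite -[wreath_set]/(gval (Group group_set_wreath_set)) gen_subG.
  apply/subsetP=> _ /imsetP[i _ ->]; apply/wreath_setP.
  rewrite /x' /wreath_family; case: ltnP => [ilt|_].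
    exists 0%R, (single 0%R (x i)); split=> // s; rewrite /single.
    case: eqP => _; last exact: group1.
    by apply/mem_gen/imsetP; exists (Ordinal ilt).
  by exists 1%R, (fun=> 1); split.
apply/subsetP=> _ /wreath_setP[e [f [fH ->]]].
have -> : wreath_perm e f = shift_perm T p ^+ e * wreath_perm 0%R f.
  rewrite shift_perm_Zp wreath_permM GRing.addr0; apply: eq_wreath_perm => s.
  by rewrite mul1g.
apply: groupM; last first.
  by rewrite base_perm_prod; apply: group_prod => s _; apply: coord_perm_gen.
apply/groupX/mem_gen/imsetP; exists ord_max => //.
by rewrite /x' /wreath_family ltnn.
Qed.

Lemma card_wreath_family_gen (t0 : T) : #|K| = (p * #|H| ^ p)%N.
Proof.
rewrite wreath_family_gen card_imset; last first.
  move=> [e f] [d g] /= /(wreath_perm_inj t0)[-> fg].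
  by congr (_, _); apply/ffunP.
by rewrite cardsX cardsT cardsE card_ffun_on !card_ord Zp_cast.
Qed.

End WreathOrder.

(** * Normal forms of words and completeness of the relations *)

Section WreathWords.

Variables (T : finType) (p n : nat) (x : nat -> {perm T}).
Hypothesis p_gt1 : 1 < p.

Lemma letter_val_wreath_family a :
  a.1 < n -> letter_val (wreath_family p n x) a = coord_perm 0%R (letter_val x a).
Proof.
by rewrite /letter_val /wreath_family => ->; case: ifP; rewrite ?coord_permV.
Qed.

(** The counterpart of [mul_base_letter]: the letter enters the component of the same index e.
    Likewise [shift_perm_mul] is the counterpart of [mul_top_letter]. *)
Lemma coord_perm_mul (h : {perm T}) (e : 'Z_p) f :
  coord_perm 0%R h * wreath_perm e f =
  wreath_perm e (fun s => if s == e then h * f s else f s).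
Proof.
rewrite wreath_permM GRing.add0r; apply: eq_wreath_perm => s.
by rewrite /single GRing.subr_eq0; case: eqP; rewrite ?mul1g.
Qed.

Lemma shift_perm_mul b (e : 'Z_p) f :
  letter_val (wreath_family p n x) (n, b) * wreath_perm e f =
  wreath_perm (if b then e - 1 else e + 1)%R f.
Proof.
have sh d : shift_perm T p * wreath_perm d f = wreath_perm (d + 1)%R f.
  rewrite wreath_permM GRing.addrC; apply: eq_wreath_perm => s.
  by rewrite mul1g.
rewrite /letter_val /wreath_family ltnn; case: b; last exact: sh.
by apply: (mulgI (shift_perm T p)); rewrite sh GRing.subrK; apply: mulVKg.
Qed.

(** The point is that the same e and the same words u_s serve in [Q] and in the wreath product,
    since a new letter changes them in the same way on both sides. *)
Lemma wreath_word_normal_form (Q : groupType) (y : nat -> Q) w :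
    power_relations p n.+1 y ->
    commutator_relations (distinct_conjugates p) n.+1 y ->
    letters_below n.+1 w ->
  exists (e : 'Z_p) (u : 'Z_p -> word nat),
    [/\ forall s, letters_below n (u s),
        word_val y w = wreath_normal_form n y e u &
        word_val (wreath_family p n x) w =
          wreath_perm e (fun s => word_val x (u s))].
Proof.
move=> yp yc; elim: w => [_|[i b] w IHw /= /andP[]].
  exists 0%R, (fun=> [::]); split=> //.
    rewrite word_val_nil /wreath_normal_form mul1g big1 // => s _.
    by rewrite word_val_nil conj1g.
  rewrite word_val_nil -(wreath_perm1 T p); apply: eq_wreath_perm => s.
  by rewrite word_val_nil.
rewrite ltnS => in_ /IHw[e [u [un yw xw]]]; rewrite !word_val_cons yw xw.
move: in_; rewrite leq_eqVlt => /orP[/eqP-> |ilt].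
  exists (if b then e - 1 else e + 1)%R, u; split=> //.
    exact: mul_top_letter.
  exact: shift_perm_mul.
exists e, (fun s => if s == e then (i, b) :: u s else u s); split.
- by move=> s; case: ifP => //= _; rewrite /letters_below /= ilt; apply: un.
- exact: mul_base_letter.
- rewrite letter_val_wreath_family // coord_perm_mul; apply: eq_wreath_perm => s.
  by case: ifP; rewrite // word_val_cons.
Qed.

(** The universal property of a presentation: on words in the first m letters, the kernel of [z] is
    contained in that of every family satisfying the relations. Quantifying over [Q] lets the
    induction reuse the same group and family with fewer letters. *)
Definition relation_faithful m (U : finType) (z : nat -> {perm U}) :=
  forall (Q : groupType) (y : nat -> Q),
    power_relations p m y -> commutator_relations (distinct_conjugates p) m y ->
  forall w, letters_below m w -> word_val z w = 1 -> word_val y w = 1.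

(** If the word is trivial in the wreath product, then e = 0 and every u_s is trivial on [T]; by the
    assumption on [x] every u_s is then trivial in [Q] too. *)
Lemma wreath_relation_faithful (t0 : T) :
  relation_faithful n x -> relation_faithful n.+1 (wreath_family p n x).
Proof.
move=> xF Q y yp yc w wn.
have [e [u [un -> ->]]] := wreath_word_normal_form yp yc wn.
rewrite -(wreath_perm1 T p) => /(wreath_perm_inj t0)[-> u1].
rewrite /wreath_normal_form mul1g big1 // => s _.
rewrite (xF Q y _ _ _ (un s) (u1 s)) ?conj1g // => [i|l i j k] /leqW.
  exact: yp.
exact: yc.
Qed.

End WreathWords.

(** Legendre's formula: the terms p^n / p^k with k > n vanish, and the others are summed in reverse
    order. *)
Lemma logn_fact_expn p n : prime p -> logn p (p ^ n)`! = \sum_(i < n) p ^ i.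
Proof.
move=> pp; have p_gt1 := prime_gt1 pp; rewrite logn_fact //.
have n_le : n.+1 <= (p ^ n).+1 by apply/ltnW/ltn_expl.
rewrite (big_cat_nat (ltn0Sn n) n_le).
rewrite /= [X in (_ + X)%N]big_nat_cond [X in (_ + X)%N]big1 => [|k]; last first.
  by case/andP=> /andP[nk _] _; rewrite divn_small ?ltn_exp2l.
rewrite addn0 big_add1 big_mkord (reindex_inj rev_ord_inj) /=.
apply: eq_bigr => i _; rewrite -expnB ?prime_gt0 //; last first.
  by rewrite -subSn ?subSS ?leq_subr.
by rewrite -subSn ?subSS ?subKn // ltnW.
Qed.

(** Starting from a single point, each wreath product with Z/p multiplies the degree by p. The
    exponent of the order is the one computed in [logn_fact_expn]. *)
Lemma exists_sylow_model p n : prime p ->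
  exists (T : finType) (x : nat -> {perm T}),
    [/\ #|T| = (p ^ n)%N, #|<<[set x i | i : 'I_n]>>| = (p ^ \sum_(i < n) p ^ i)%N,
        power_relations p n x, commutator_relations (distinct_conjugates p) n x &
        relation_faithful p n x].
Proof.
move=> pp; have p_gt1 := prime_gt1 pp.
elim: n => [|n [T [x [cT cG xp xc xF]]]].
  exists unit, (fun=> 1); split=> //; first by rewrite card_unit.
    rewrite big_ord0 (_ : [set _ | _ in _] = set0) ?gen0 ?cards1 //.
    by apply/setP=> g; rewrite inE; apply/imsetP=> -[[]].
  by move=> Q y _ _ [|[]//] _ _; rewrite word_val_nil.
have /card_gt0P[t0 _] : 0 < #|T| by rewrite cT expn_gt0 prime_gt0.
exists (T * 'Z_p)%type, (wreath_family p n x); split.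
- by rewrite card_prod card_ord Zp_cast // cT expnSr.
(* The exponent S of the order becomes 1 + p S, which prolongs the geometric sum by one term. *)
- rewrite (card_wreath_family_gen n x p_gt1 t0) cG -expnM -expnS; congr expn.
  rewrite big_ord_recl expn0 -addn1 addnC; congr addn.
  by rewrite big_distrl; apply: eq_bigr => i _; rewrite /= expnSr.
- exact: wreath_power_relations.
- by apply: wreath_commutator_relations.
- exact: wreath_relation_faithful.
Qed.

(** * Independence of the relators *)

Lemma shift_perm_neq1 (T : finType) (t0 : T) p k :
  1 < p -> ~~ (p %| k) -> shift_perm T p ^+ k <> 1.
Proof.
move=> p_gt1 pk; rewrite shift_permX -(wreath_perm1 T p) => /(wreath_perm_inj t0)[].
by move/eqP; rewrite natr_Zp_eq0 // (negPf pk).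
Qed.

(** In the wreath product of two cyclic groups of order p, the shift b moves the element a from
    block 0 to block 1, so conjugation by b changes a. *)
Lemma exists_noncommuting p : 1 < p ->
  exists (U : finType) (a b : {perm U}),
    [/\ a ^+ p = 1, b ^+ p = 1 & ~ commute a b].
Proof.
move=> p_gt1; pose c := shift_perm unit p.
exists ((unit * 'Z_p) * 'Z_p)%type, (coord_perm 0%R c), (shift_perm _ p).
have cp : c ^+ p = 1 by apply: shift_perm_order.
split; last 1 first.
- move/commute_sym => cab.
  have := coord_permJ (0%R : 'Z_p) c 1%R; rewrite GRing.add0r -/(shift_perm _ p).
  rewrite (_ : _ ^ _ = coord_perm 0%R c); last by rewrite conjgE -cab mulKg.
  case/(wreath_perm_inj (tt, 0%R : 'Z_p)) => _ /(_ 1%R).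
  rewrite /single eqxx GRing.oner_eq0 -(expg1 c) => /esym.
  by apply: shift_perm_neq1; rewrite ?dvdn1 ?gtn_eqF.
- by rewrite coord_permX cp; exact: (esym (coord_permX (0%R : 'Z_p) 1 0)).
- exact: shift_perm_order.
Qed.

(** The clause for p = 2 restricts to the half of the commutators kept in [sylow2_relator], so that
    one argument covers both families. *)
Definition other_commutators (p l0 i0 j0 k0 l i j k : nat) : Prop :=
  [/\ 0 < k, k.*2 <= p, p = 2 -> i <= j & (l, i, j, k) <> (l0, i0, j0, k0)].

Section Independence.

Variables (p l0 i0 j0 k0 : nat).
Hypotheses (pp : prime p) (il0 : i0 < l0) (jl0 : j0 < l0).
Hypotheses (k0_gt0 : 0 < k0) (k0_le : k0.*2 <= p) (p2 : p = 2 -> i0 <= j0).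

Let p_gt1 : 1 < p := prime_gt1 pp.

Lemma double_le_lt k : 0 < k -> k.*2 <= p -> 0 < k < p.
Proof.
by move=> k_gt0; rewrite k_gt0; apply: leq_trans; rewrite -addnn -addn1 leq_add2l.
Qed.

Lemma natr_Zp_inj k m : k < p -> m < p -> k%:R%R = m%:R%R :> 'Z_p -> k = m.
Proof.
move=> kp mp /(congr1 val); rewrite /= !val_Zp_nat // !modn_small //.
Qed.

Section BaseLevel.

Variables (U : finType) (a b : {perm U}).
Hypotheses (ap : a ^+ p = 1) (bp : b ^+ p = 1) (nab : ~ commute a b).

Definition witness_coord (i : nat) (s : 'Z_p) : {perm U} :=
  if (i == j0) && (s == 0%R) then b
  else if (i == i0) && (s == k0%:R%R) then a else 1.

Definition witness_family (i : nat) : {perm U * 'Z_p} :=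
  if i < l0 then wreath_perm 0%R (witness_coord i) else shift_perm U p.

Lemma k0_neq0 : (k0%:R == 0%R :> 'Z_p)%R = false.
Proof.
have /andP[_ k0p] := double_le_lt k0_gt0 k0_le.
by rewrite natr_Zp_eq0 // gtnNdvd.
Qed.

Lemma witness_coordP i s :
  [\/ [/\ i = j0, s = 0%R & witness_coord i s = b],
      [/\ i = i0, s = k0%:R%R & witness_coord i s = a] | witness_coord i s = 1].
Proof.
rewrite /witness_coord; case: andP => [[/eqP ij /eqP s0]|_]; first by constructor 1.
by case: andP => [[/eqP ij /eqP s0]|_]; [constructor 2|constructor 3].
Qed.

Lemma witness_power : power_relations p l0.+1 witness_family.
Proof.
move=> i _; rewrite /witness_family; case: ifP => _; last exact: shift_perm_order.
rewrite base_permX -(wreath_perm1 U p); apply: eq_wreath_perm => s.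
by case: (witness_coordP i s) => [[_ _ ->]|[_ _ ->]|->] //; rewrite expg1n.
Qed.

(** The elements a and b sit in the blocks k0 and 0, which are distinct, so they never meet in one
    component. *)
Lemma witness_coord_commute i j s : commute (witness_coord i s) (witness_coord j s).
Proof.
case: (witness_coordP i s) => [[_ s0 ->]|[_ sk ->]|->];
  last exact/commute_sym/commute1;
  case: (witness_coordP j s) => [[_ s0' ->]|[_ sk' ->]|->] //; try exact: commute1.
- by have := k0_neq0; rewrite -sk' s0 eqxx.
- by have := k0_neq0; rewrite -sk s0' eqxx.
Qed.

(** Commutation can fail only where one component is a and the other is b. This happens in two ways,
    and each leads to the excluded indices. *)
Lemma witness_shift_commute i j k :
    other_commutators p l0 i0 j0 k0 l0 i j k ->
  forall s, commute (witness_coord i s) (witness_coord j (s - k%:R)%R).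
Proof.
case=> k_gt0 k_le pij ne s.
have /andP[_ kp] := double_le_lt k_gt0 k_le.
have /andP[_ k0p] := double_le_lt k0_gt0 k0_le.
case: (witness_coordP i s) => [[ii ss ->]|[ii ss ->]|->];
  last exact/commute_sym/commute1;
  case: (witness_coordP j (s - k%:R)%R) => [[jj tt ->]|[jj tt ->]|->] //;
  try exact: commute1.
(* Here i = j0 contributes b and j = i0 contributes a, so p divides k0 + k. Both being at most p/2,
   this forces k0 = k and p = 2; the ordering of the indices then gives i0 = j0. *)
- have /eqP := tt; rewrite ss GRing.sub0r eq_sym -GRing.addr_eq0 -GRing.natrD.
  rewrite natr_Zp_eq0 // => p_dvd.
  have kk_le : k0 + k <= p.
    by rewrite -leq_double doubleD -[p.*2]addnn leq_add.
  have kk : k0 + k = p.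
    by apply/eqP; rewrite eqn_leq kk_le dvdn_leq // addn_gt0 k_gt0 orbT.
  have k0k : k0 = k.
    apply/eqP; rewrite eqn_leq -(leq_add2l k0) kk addnn k0_le /=.
    by rewrite -(leq_add2r k) kk addnn.
  have pE : p = 2 by apply/(prime_oddPn pp); rewrite -kk k0k addnn odd_double.
  case: ne; rewrite k0k ii jj; have := pij pE; have := p2 pE.
  rewrite ii jj => ij ji; suff -> : i0 = j0 by [].
  by apply/eqP; rewrite eqn_leq ij.
(* Here i = i0 contributes a in block k0, and j = j0 contributes b, moved from block 0 to block
   k. *)
- have kk : k0 = k.
    by apply: natr_Zp_inj => //; apply/eqP; rewrite -GRing.subr_eq0 -ss tt.
  by case: ne; rewrite ii jj kk.
Qed.

Lemma witness_commutator :
  commutator_relations (other_commutators p l0 i0 j0 k0) l0.+1 witness_family.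
Proof.
move=> l i j k; rewrite ltnS leq_eqVlt => /orP[/eqP-> |ln] il jl Ck.
  rewrite /witness_family il jl ltnn shift_permX base_permJ /commute !base_permM.
  by apply: eq_wreath_perm => s; apply: witness_shift_commute.
(* For l < l0 all three generators lie in the base and commute pairwise, so conjugation by x_l fixes
   x_j. *)
have base_com m h : m < l0 -> h < l0 -> commute (witness_family m) (witness_family h).
  move=> ml hl; rewrite /witness_family ml hl /commute !base_permM.
  by apply: eq_wreath_perm => s; apply: witness_coord_commute.
have [il0' jl0'] := (ltn_trans il ln, ltn_trans jl ln).
have /commgP := commuteX k (base_com _ _ jl0' ln); rewrite -conjg_fix => /eqP->.
exact: base_com.
Qed.

Lemma witness_noncommute :
  ~ commute (witness_family i0) (witness_family j0 ^ (witness_family l0 ^+ k0)).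
Proof.
(* Over an empty set any two permutations are equal, so a and b would commute. *)
have u0 : U.
  by case: (pickP U) => [//|U0]; case: nab; apply/permP=> t; have := U0 t.
rewrite /witness_family il0 jl0 ltnn shift_permX base_permJ.
move/(base_perm_commute u0)/(_ k0%:R%R); rewrite GRing.subrr /witness_coord !eqxx.
by rewrite k0_neq0 andbF.
Qed.

End BaseLevel.

Lemma commutator_independent n : l0 < n ->
  exists (U : finType) (z : nat -> {perm U}),
    [/\ power_relations p n z,
        commutator_relations (other_commutators p l0 i0 j0 k0) n z &
        ~ commute (z i0) (z j0 ^ (z l0 ^+ k0))].
Proof.
elim: n => [//|n IHn]; rewrite ltnS leq_eqVlt => /orP[/eqP <-|l0n].
  have [U [a [b [ap bp nab]]]] := exists_noncommuting p_gt1.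
  exists (U * 'Z_p)%type, (witness_family a b); split.
  - exact: witness_power.
  - exact: witness_commutator.
  - exact: witness_noncommute.
have [U [z [zp zc nz]]] := IHn l0n.
exists (U * 'Z_p)%type, (wreath_family p n z); split.
- exact: wreath_power_relations.
- apply: wreath_commutator_relations => // l i j k [k_gt0 k_le _ _].
  exact: double_le_lt.
- have u0 : U.
    by case: (pickP U) => [//|U0]; case: nz; apply/permP=> t; have := U0 t.
  rewrite /wreath_family l0n (ltn_trans il0 l0n) (ltn_trans jl0 l0n).
  by rewrite coord_permX coord_permJcoord => /(coord_perm_commuteE u0).
Qed.

End Independence.

(** * The Sylow subgroup of the symmetric group *)

Section Transfer.

Variables (T T' : finType) (h : T -> T') (h' : T' -> T).
Hypotheses (hK : cancel h h') (h'K : cancel h' h).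

Lemma perm_transfer_inj (s : {perm T}) : injective (fun t => h (s (h' t))).
Proof. exact: inj_comp (can_inj hK) (inj_comp perm_inj (can_inj h'K)). Qed.

Definition perm_transfer s : {perm T'} := perm (@perm_transfer_inj s).

Lemma perm_transferM : {morph perm_transfer : s t / s * t}.
Proof. by move=> s t; apply/permP=> u; rewrite !permE /= !permE hK. Qed.

Lemma perm_transfer_morph_inj : injective perm_transfer.
Proof.
move=> s t /permP st; apply/permP=> u; apply: (can_inj hK).
by have := st (h u); rewrite !permE hK.
Qed.

End Transfer.

Section InjectiveMorphism.

Variables (gT hT : finGroupType) (f : gT -> hT) (p n : nat) (x : nat -> gT).
Hypotheses (fM : {morph f : u v / u * v}) (f_inj : injective f).

Let f1 : f 1 = 1.
Proof. by apply: (mulgI (f 1)); rewrite -fM !mulg1. Qed.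

Let fX u k : f (u ^+ k) = f u ^+ k.
Proof. by elim: k => [|k IHk]; rewrite ?expg0 // !expgS fM IHk. Qed.

Let fJ u v : f (u ^ v) = f u ^ f v.
Proof.
by apply: (mulgI (f v)); rewrite -fM -!conjgC fM.
Qed.

Lemma power_relations_morph : power_relations p n x -> power_relations p n (f \o x).
Proof. by move=> xp i /xp x1; rewrite /= -fX x1. Qed.

Lemma commutator_relations_morph C :
  commutator_relations C n x -> commutator_relations C n (f \o x).
Proof.
move=> xc l i j k ln il jl Ck; rewrite /= /commute -fX -fJ -!fM.
by rewrite (xc _ _ _ _ ln il jl Ck).
Qed.

Lemma card_gen_morph :
  #|<<[set f (x i) | i : 'I_n]>>| = #|<<[set x i | i : 'I_n]>>|.
Proof.
pose fm := Morphism (in2W fM : {in [set: gT] &, {morph f : u v / u * v}}).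
have injf : 'injm fm by apply/injmP=> u v _ _; apply: f_inj.
rewrite -(card_injm injf (subsetT _)) morphim_gen ?subsetT //.
by rewrite morphimEsub ?subsetT // -imset_comp.
Qed.

End InjectiveMorphism.

Lemma gen_word_val (I : finType) (gT : finGroupType) (x : I -> gT) (J : {set I}) g :
    g \in <<[set x i | i in J]>> ->
  exists2 w : word I, all (fun a => a.1 \in J) w & g = weval x w.
Proof.
case/gen_prodgP=> m [c cx ->]; elim: m c cx => [|m IHm] c cx.
  by exists [::]; rewrite // /weval big_nil big_ord0.
have /imsetP[i iJ ci] := cx ord0.
have [j|w wJ Ew] := IHm (fun j => c (lift ord0 j)); first exact: cx.
exists ((i, false) :: w); first by rewrite /= iJ.
by rewrite big_ord_recl ci Ew /weval big_cons.
Qed.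

(** Links families indexed by ['I_n], as in [presentation], to the families indexed by nat on which
    the induction runs. *)
Definition extend n (G : groupType) (y : 'I_n -> G) (i : nat) : G :=
  if insub i is Some j then y j else 1.

Lemma extend_val n (G : groupType) (y : 'I_n -> G) : extend y \o val =1 y.
Proof. by move=> i; rewrite /extend /= valK. Qed.

Section RelatorsAsRelations.

Variables (p n : nat) (G : groupType) (y : nat -> G).

Definition half_conjugates (l i j k : nat) : Prop := 0 < k /\ k.*2 <= p.

Lemma word_val_power (i : 'I_n) :
  word_val (y \o val) (wexp (wgen i) p) = y i ^+ p.
Proof. by rewrite word_val_exp word_val_gen. Qed.

Lemma word_val_commutator (l i j : 'I_n) k :
  word_val (y \o val) (wcomm (wgen i) (wconj (wgen j) (wexp (wgen l) k))) =
  [~ y i, y j ^ (y l ^+ k)].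
Proof. by rewrite word_val_comm word_val_conj word_val_exp !word_val_gen. Qed.

Lemma sylow_relatorsE :
    (forall r, @sylow_relator p n r -> word_val (y \o val) r = 1) <->
  power_relations p n y /\ commutator_relations half_conjugates n y.
Proof.
split=> [yR|[yp yc] _ [i|l i j k il jl k_gt0 k_le]].
- split=> [i ilt|l i j k ln il jl [k_gt0 k_le]].
    by rewrite -(word_val_power (Ordinal ilt)) yR //; constructor.
  apply/commgP/eqP; have [in_ jn] := (ltn_trans il ln, ltn_trans jl ln).
  rewrite -(word_val_commutator (Ordinal ln) (Ordinal in_) (Ordinal jn)).
  by apply: yR; constructor.
- by rewrite word_val_power yp.
- by rewrite word_val_commutator; apply/eqP/commgP/yc.
Qed.

End RelatorsAsRelations.

Lemma sylow2_relatorsE n (G : groupType) (y : nat -> G) :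
    (forall r, @sylow2_relator n r -> word_val (y \o val) r = 1) <->
  power_relations 2 n y /\
  commutator_relations (fun _ i j k => i <= j /\ k = 1%N) n y.
Proof.
split=> [yR|[yp yc] _ [i|l i j ij jl]].
- split=> [i ilt|l i j k ln il jl [ij ->]].
    by rewrite -(word_val_power 2 y (Ordinal ilt)) yR //; constructor.
  apply/commgP/eqP; have [in_ jn] := (ltn_trans il ln, ltn_trans jl ln).
  rewrite -(word_val_commutator y (Ordinal ln) (Ordinal in_) (Ordinal jn)).
  by apply: yR; apply: sylow2_commutator.
- by rewrite word_val_power yp.
- rewrite (word_val_commutator y l i j 1); apply/eqP/commgP/yc => //.
  exact: leq_ltn_trans jl.
Qed.

(** Only k = 1 occurs. For j < i, conjugating the relation of (l, j, i) by the involution x_l gives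
    that of (l, i, j). *)
Lemma sylow2_half_conjugates n (G : groupType) (y : nat -> G) :
    power_relations 2 n y ->
    commutator_relations (fun _ i j k => i <= j /\ k = 1%N) n y ->
  commutator_relations (half_conjugates 2) n y.
Proof.
move=> yp yc l i j k ln il jl [k_gt0 k_le].
have {k k_gt0 k_le} -> : k = 1%N by case: k k_gt0 k_le => [|[|k]].
have [ij|/ltnW ji] := leqP i j; first exact: yc.
have := yc l j i 1%N ln jl il (conj ji erefl) => /(commuteJ (y l ^+ 1))/commute_sym.
by rewrite -conjgM -expgnDr yp // conjg1.
Qed.

(** * Minimal presentations, for both families of relators at once *)

Section Relators.

Variables (p n : nat) (P : {group 'S_(p ^ n)}) (x : nat -> 'S_(p ^ n)).
Variable R : word 'I_n -> Prop.
Hypothesis pp : prime p.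
Hypothesis genP : <<[set x i | i : 'I_n]>> = P.
Hypotheses (xF : relation_faithful p n x).
Hypothesis R_val : forall r, R r -> word_val (x \o val) r = 1.
Hypothesis R_relations : forall (G : groupType) (y : nat -> G),
  (forall r, R r -> word_val (y \o val) r = 1) ->
  power_relations p n y /\ commutator_relations (half_conjugates p) n y.
Let p_gt1 := prime_gt1 pp.

Lemma relators_presentation : presentation P (x \o val) R.
Proof.
split; first by rewrite -genP.
move=> w; split; last by exact: normal_closure_word_val.
(* The group presented by [R] satisfies the relations, so faithfulness of [x] makes every word
   trivial in [P] trivial there. *)
have [G [y yR]] := exists_presented_group R.
have [yp yc] : power_relations p n (extend y) /\
               commutator_relations (half_conjugates p) n (extend y).
  apply: R_relations => r Rr; rewrite (eq_word_val (extend_val y)).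
  exact/yR/nc_rel.
rewrite -[weval _ _]/(word_val _ _) => xw; apply/yR.
rewrite -(eq_word_val (extend_val y)) -(word_val_map (val : 'I_n -> nat)).
apply: (xF (y := extend y) yp).
- exact: distinct_conjugates_half.
- by apply/allP=> a /mapP[b _ ->] /=.
- by rewrite word_val_map.
Qed.

(** Holds for [sylow2_relator], and for [sylow_relator] when p > 2 or n <= 2. At p = 2 it keeps one
    relator from each pair of equivalent ones. *)
Hypothesis R_form : forall r, R r ->
  (exists i, r = wexp (wgen i) p) \/
  (exists (l i j : 'I_n) (k : nat),
    [/\ (i < l) && (j < l), 0 < k, k.*2 <= p, p = 2 -> i <= j &
     r = wcomm (wgen i) (wconj (wgen j) (wexp (wgen l) k))]).

(** The order q of the surviving generator is p when a generator is tested and p^2 when a power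
    relator is. *)
Definition cyclic_family q (m : 'I_n) (i : nat) :=
  if i == m then shift_perm unit q else 1.

Lemma cyclic_commutator q m C : commutator_relations C n (cyclic_family q m).
Proof.
have com i j : commute (cyclic_family q m i) (cyclic_family q m j).
  rewrite /cyclic_family; case: ifP => _; last exact/commute_sym/commute1.
  by case: ifP => _ //; apply: commute1.
move=> l i j k _ _ _ _.
have /commgP := commuteX k (com j l); rewrite -conjg_fix => /eqP->.
exact: com.
Qed.

Lemma relators_minimal_generators : minimal_generators P (x \o (val : 'I_n -> nat)).
Proof.
move=> J /properP[_ [m _ mJ]] genJ.
have : x m \in <<[set (x \o val) i | i in J]>>.
  by rewrite genJ -genP mem_gen //; apply/imsetP; exists m.
case/gen_word_val=> w wJ xw.
(* If x_m were a word w in the other generators, x_m^-1 w would be a consequence of [R], yet it does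
   not vanish on the cyclic family. *)
have : normal_closure R (winv (wgen m) ++ w).
  apply/(relators_presentation.2).
  rewrite -[weval _ _]/(word_val _ _) word_val_cat word_val_inv word_val_gen.
  by rewrite -[word_val _ w]/(weval _ _) -xw mulVg.
pose c := cyclic_family p m.
have cR r : R r -> word_val (c \o val) r = 1.
  case/R_form=> [[i ->]|[l [i [j [k [/andP[il jl] _ _ _ ->]]]]]].
    rewrite word_val_power /c /cyclic_family; case: eqP => _; last exact: expg1n.
    exact: shift_perm_order.
  rewrite word_val_commutator; apply/eqP/commgP.
  exact: (@cyclic_commutator p m (fun _ _ _ _ => True)).
move/(normal_closure_word_val cR); rewrite word_val_cat word_val_inv word_val_gen.
have -> : word_val (c \o val) w = 1.
  elim: w wJ {xw} => [|a w IHw] /=; first by rewrite word_val_nil.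
  case/andP=> aJ /IHw wc; rewrite word_val_cons wc mulg1 /letter_val /=.
  have -> : c a.1 = 1.
    rewrite /c /cyclic_family; case: eqP => // /val_inj am.
    by rewrite am (negPf mJ) in aJ.
  by rewrite invg1 if_same.
rewrite mulg1 /c /cyclic_family /= eqxx => /eqP; rewrite invg_eq1 => /eqP.
by rewrite -(expg1 (shift_perm _ _)); apply: shift_perm_neq1; rewrite ?dvdn1 ?gtn_eqF.
Qed.

Lemma relators_irredundant : irredundant R.
Proof.
move=> r Rr; case: (R_form Rr) =>
  [[m rE]|[l0 [i0 [j0 [k0 [/andP[il jl] k_gt0 k_le ij rE]]]]]].
  (* In a cyclic group of order p^2 the commutators and the powers of the killed generators are
     trivial, but x_m^p is not. *)
  pose c := cyclic_family (p ^ 2) m.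
  have cR s : R s /\ s <> r -> word_val (c \o val) s = 1.
    case=> /R_form[[i ->]|[l [i [j [k [/andP[il jl] _ _ _ ->]]]]]] ne.
      rewrite word_val_power /c /cyclic_family; case: eqP => [im|_]; last exact: expg1n.
      by case: ne; rewrite rE (val_inj im).
    rewrite word_val_commutator; apply/eqP/commgP.
    exact: (@cyclic_commutator _ m (fun _ _ _ _ => True)).
  move/(normal_closure_word_val cR); rewrite rE word_val_power /c /cyclic_family eqxx.
  apply: shift_perm_neq1; rewrite // ?(ltn_exp2l 0) //.
  by rewrite -{2}(expn1 p) dvdn_Pexp2l.
have [U [z [zp zc nz]]] :=
  commutator_independent pp il jl k_gt0 k_le ij (ltn_ord l0).
have zR s : R s /\ s <> r -> word_val (z \o val) s = 1.
  case=> /R_form[[i ->]|[l [i [j [k [/andP[il' jl'] k_gt0' k_le' ij' ->]]]]]] ne.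
    by rewrite word_val_power zp.
  rewrite word_val_commutator; apply/eqP/commgP/zc => //; split=> // [[ll ii jj kk]].
  by case: ne; rewrite rE (val_inj ll) (val_inj ii) (val_inj jj) kk.
move/(normal_closure_word_val zR); rewrite rE word_val_commutator => /eqP/commgP.
exact: nz.
Qed.

Lemma relators_minimal_presentation : minimal_presentation P (x \o val) R.
Proof.
by split; [exact: relators_presentation | exact: relators_minimal_generators
          | exact: relators_irredundant].
Qed.

End Relators.

Lemma sylow_generators p n (P : {group 'S_(p ^ n)}) :
    prime p -> p.-Sylow([set: 'S_(p ^ n)]) P ->
  exists x : nat -> 'S_(p ^ n),
    [/\ <<[set x i | i : 'I_n]>> = P, power_relations p n x,
        commutator_relations (distinct_conjugates p) n x & relation_faithful p n x].
Proof.
move=> pp sylP; have [T [x [cT cG xp xc xF]]] := exists_sylow_model n pp.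
pose h (t : T) : 'I_(p ^ n) := cast_ord cT (enum_rank t).
pose h' (i : 'I_(p ^ n)) : T := enum_val (cast_ord (esym cT) i).
have hK : cancel h h' by move=> t; rewrite /h' /h cast_ordK enum_rankK.
have h'K : cancel h' h by move=> i; rewrite /h' /h enum_valK cast_ordKV.
pose f := perm_transfer hK h'K.
have fM : {morph f : u v / u * v} := perm_transferM hK h'K.
have f_inj : injective f := @perm_transfer_morph_inj _ _ _ _ hK h'K.
(* The model has for order the full power of p dividing (p^n)!, so its image is a Sylow subgroup,
   and hence conjugate to [P]. *)
have sylK : p.-Sylow([set: 'S_(p ^ n)]) <<[set f (x i) | i : 'I_n]>>.
  rewrite pHallE subsetT /= card_gen_morph // cG p_part.
  by rewrite cardsT card_Sn logn_fact_expn.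
have [g _ Pg] := Sylow_trans sylK sylP.
pose F u := f u ^ g.
have FM : {morph F : u v / u * v} by move=> u v; rewrite /F fM conjMg.
have F_inj : injective F by move=> u v /conjg_inj/f_inj.
exists (F \o x); split.
- rewrite -[RHS]/(gval P) Pg -genJ; congr <<_>>; rewrite /conjugate -imset_comp.
  by [].
- exact: power_relations_morph.
- exact: commutator_relations_morph.
- move=> Q y yp yc w wn; rewrite -morph_word_val // => Fw.
  apply: (xF _ _ yp yc _ wn); apply: F_inj; rewrite Fw.
  by apply: (mulgI (F 1)); rewrite -FM !mulg1.
Qed.

Theorem corollary4 (p n : nat) (P : {group 'S_(p ^ n)}) :
  prime p -> 1 <= n -> (p.-Sylow([set: 'S_(p ^ n)]) P)%g ->
  exists x : 'I_n -> 'S_(p ^ n),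
    [/\ presentation P x (@sylow_relator p n),
        2 < p \/ n <= 2 -> minimal_presentation P x (@sylow_relator p n) &
        p = 2 -> minimal_presentation P x (@sylow2_relator n)].
Proof.
move=> pp _ sylP; have [x [genP xp xc xF]] := sylow_generators pp sylP.
exists (x \o val).
have rel (G : groupType) (y : nat -> G) := @sylow_relatorsE p n G y.
have x_rel r : @sylow_relator p n r -> word_val (x \o val) r = 1.
  apply: (rel _ x).2; split=> // l i j k ln il jl [k_gt0 k_le].
  by apply: xc; rewrite // /distinct_conjugates; apply: double_le_lt.
split=> [|p_n|p2].
- exact: (relators_presentation genP xF x_rel (fun G y => (rel G y).1)).
- apply: (relators_minimal_presentation pp genP xF x_rel (fun G y => (rel G y).1)).
  move=> _ [i|l i j k il jl k_gt0 k_le]; [by left; exists i | right].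
  exists l, i, j, k; split=> // [|p2]; first by rewrite il.
  (* For p = 2 the case n <= 2 remains, where i < l <= 1 gives i = 0 and thus i <= j. *)
  case: p_n => [|n2]; first by rewrite p2.
  have l1 : l <= 1 := leq_trans (ltn_ord l) n2.
  by have := leq_trans il l1; rewrite ltnS leqn0 => /eqP->.
- subst p; apply: (relators_minimal_presentation pp genP xF).
  + apply: (sylow2_relatorsE n x).2; split=> // l i j k ln il jl [_ ->].
    exact: xc.
  + move=> G y /(sylow2_relatorsE n y).1 [yp yc]; split=> //.
    exact: sylow2_half_conjugates.
  + move=> _ [i|l i j ij jl]; [by left; exists i | right].
    by exists l, i, j, 1%N; split=> //; rewrite jl (leq_ltn_trans ij jl).
Qed.
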